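(* The Veech group $\Gamma(D)$ of the origami $D$ is a non congruence group.
   Context: Fix the torus $E=\mathbb{C}/(\mathbb{Z}\oplus\mathbb{Z}i)$ (the unit square with opposite edges glued), and let $\infty\in E$ be the image of the vertices of the square. An origami of degree $d$ is a covering $p:X\to E$ of degree $d$ from a closed, oriented, connected surface $X$, ramified over at most $\infty$. Equivalently, it is given by a pair of permutations $(\sigma_a,\sigma_b)$ in $S_d$ generating a transitive group (up to simultaneous conjugation): take $d$ copies of the Euclidean unit square numbered $1,\dots,d$, and glue by translations the right edge of square $i$ to the left edge of square $\sigma_a(i)$ and the upper edge of square $i$ to the lower edge of square $\sigma_b(i)$. The origami $D$ is the origami of degree $5$ given by $$\sigma_a=(1\ 2\ 3),\qquad \sigma_b=(1\ 4\ 5)(2\ 3).$$ Veech group: for an origami $O=(p:X\to E)$ put $X^*=X-p^{-1}(\infty)$, with the translation structure $\mu_I$ obtained by lifting via $p$ the natural one of $\mathbb{C}/(\mathbb{Z}\oplus\mathbb{Z}i)$ (i.e. identifying the squares with Euclidean unit squares). The Veech group $\Gamma(O)$ is the group of all matrices $A$ such that there is an orientation preserving diffeomorphism of $X^*$ which in local charts of $\mu_I$ has the form $z\mapsto Az+z_0$ ($A\in\mathrm{GL}_2(\mathbb{R})$ is independent of the charts). It is a finite index subgroup of $\mathrm{SL}_2(\mathbb{Z})$. A congruence group is a subgroup of $\mathrm{SL}_2(\mathbb{Z})$ that contains $\Gamma(n)=\ker(\mathrm{SL}_2(\mathbb{Z})\to\mathrm{SL}_2(\mathbb{Z}/n\mathbb{Z}))$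 for some $n\ge1$. A non congruence group is a subgroup of $\mathrm{SL}_2(\mathbb{Z})$ that is not a congruence group. *)

(* Defs.v *)
From HB Require Import structures.
From mathcomp Require Import all_boot all_order all_algebra all_fingroup.
From mathcomp Require Import generic_quotient.
From mathcomp Require Import all_classical all_reals all_analysis.
Import numFieldNormedType.Exports.

Set Implicit Arguments.
Unset Strict Implicit.
Unset Printing Implicit Defensive.

Import Order.TTheory GRing.Theory Num.Theory.

Local Open Scope ring_scope.
Local Open Scope classical_set_scope.

Record origami (d : nat) := Origami {
  sigma_a : 'S_d;
  sigma_b : 'S_d;
  origami_transitive :
    [transitive <<[set sigma_a; sigma_b]%SET>>, on [set: 'I_d]%SET | 'P] }.

Section Surface.
Variables (R : realType) (d : nat) (O : origami d).

(* The complex plane is 'cV[R]_2: z 0 0 is the real part of z and z 1 0 its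
   imaginary part. *)
Local Notation plane := 'cV[R]_2.

Definition vec (x y : R) : plane := \col_i (if i == 0 then x else y).

Definition punctured_square (z : plane) : bool :=
  [&& 0 <= z 0 0 <= 1, 0 <= z 1 0 <= 1 &
      ~~ ((z 0 0 \in [:: 0; 1]) && (z 1 0 \in [:: 0; 1]))].

Definition square_point := {q : 'I_d * plane | punctured_square q.2}.

Definition glue_right (p q : square_point) : bool :=
  [&& (val q).1 == sigma_a O (val p).1, (val p).2 0 0 == 1,
      (val q).2 0 0 == 0 & (val q).2 1 0 == (val p).2 1 0].

Definition glue_upper (p q : square_point) : bool :=
  [&& (val q).1 == sigma_b O (val p).1, (val p).2 1 0 == 1,
      (val q).2 1 0 == 0 & (val q).2 0 0 == (val p).2 0 0].

(* The vertices being removed, a point lies on at most one edge, so this is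
   already transitive. *)
Definition glued (p q : square_point) : bool :=
  [|| p == q, glue_right p q, glue_right q p, glue_upper p q | glue_upper q p].

Lemma glued_refl : reflexive glued.
Proof. by move=> p; rewrite /glued eqxx. Qed.

Lemma glued_sym : symmetric glued.
Proof.
move=> p q; rewrite /glued eq_sym.
by case: (q == p); case: (glue_right p q); case: (glue_right q p);
   case: (glue_upper p q); case: (glue_upper q p).
Qed.

Lemma plane_eq (z w : plane) : z 0 0 = w 0 0 -> z 1 0 = w 1 0 -> z = w.
Proof.
move=> eq_x eq_y; apply/matrixP => i j; rewrite (ord1 j).
by case: i => [[|[|//]] lt_i]; [have -> : Ordinal lt_i = 0 by apply: val_inj
                              |have -> : Ordinal lt_i = 1 by apply: val_inj].
Qed.

Lemma glued_trans : transitive glued.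
Proof.
move=> q p r.
have eqP3 (p1 p2 : square_point) : (val p1).1 = (val p2).1 ->
    (val p1).2 0 0 = (val p2).2 0 0 -> (val p1).2 1 0 = (val p2).2 1 0 ->
    p1 == p2.
  move=> e1 e2 e3; apply/eqP/val_inj; move: e1 e2 e3.
  by case: (val p1) (val p2) => [k1 z1] [k2 z2] /= -> *; congr (_, _);
     apply: plane_eq.
have b0 : 0 \in [:: 0; 1 : R] by rewrite inE eqxx.
have b1 : 1 \in [:: 0; 1 : R] by rewrite !inE eqxx orbT.
have not_vertex (x y : R) : x \in [:: 0; 1] -> y \in [:: 0; 1] ->
    (val q).2 0 0 = x -> (val q).2 1 0 = y -> False.
  by move: (valP q) => /and3P[_ _ /negP h] hx hy ux uy; apply: h; rewrite ux uy hx.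
have neq10 (t : R) : t = 1 -> t = 0 -> False.
  by move=> -> /eqP; rewrite oner_eq0.
rewrite /glued; case: (eqVneq p q) => [-> //|_] /=.
case: (eqVneq q r) => [<-|_] /=; first by move=> ->; rewrite orbT.
rewrite /glue_right /glue_upper.
case/or4P=> /and4P[/eqP e1 /eqP e2 /eqP e3 /eqP e4];
  case/or4P=> /and4P[/eqP f1 /eqP f2 /eqP f3 /eqP f4];
  first [ by case: (neq10 _ f2 e3) | by case: (neq10 _ e2 f3)
        | by case: (not_vertex _ _ _ _ e3 f2) | by case: (not_vertex _ _ _ _ f2 e3)
        | by case: (not_vertex _ _ _ _ e2 f2) | by case: (not_vertex _ _ _ _ f2 e2)
        | by case: (not_vertex _ _ _ _ e2 f3) | by case: (not_vertex _ _ _ _ f3 e2)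
        | by case: (not_vertex _ _ _ _ e3 f3) | by case: (not_vertex _ _ _ _ f3 e3)
        | by rewrite eqP3 //;
             first [ by rewrite e1 f1
                   | by apply: (@perm_inj _ (sigma_a O)); rewrite -e1 -f1
                   | by apply: (@perm_inj _ (sigma_b O)); rewrite -e1 -f1
                   | by rewrite e2 f2 | by rewrite e3 f3
                   | by rewrite e4 f4 | by rewrite -e4 -f4 ] ].
Qed.

Canonical glued_equiv := EquivRel glued glued_refl glued_sym glued_trans.

(* X^* = X - p^{-1}(oo). *)
Definition surface := {eq_quot glued_equiv}%qT.

(* point_at i z P: the point z of the i-th square becomes P in X^*. *)
Definition point_at (i : 'I_d) (z : plane) (P : surface) : Prop :=
  exists2 p : square_point, val p = (i, z) & (\pi_surface p)%qT = P.

(* The structure mu_I is given by the following atlas, whose open chart domains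
   cover X^*: the interior of the square i, a neighbourhood of the right edge
   of i and a neighbourhood of the upper edge of i.  The latter two are unions
   of two half squares, so that they are developed injectively in the plane even
   if sigma_a (resp. sigma_b) fixes i. *)
Inductive chart := Inner of 'I_d | Right of 'I_d | Upper of 'I_d.

(* Graph of the chart c, a map from its domain in X^* to the plane: chart_rel
   c P z means that P is in the domain of c and has coordinate z. *)
Definition chart_rel (c : chart) (P : surface) (z : plane) : Prop :=
  match c with
  | Inner i => [/\ 0 < z 0 0 < 1, 0 < z 1 0 < 1 & point_at i z P]
  | Right i => [/\ 2^-1 < z 0 0 < 1 + 2^-1, 0 < z 1 0 < 1 &
      point_at i z P \/ point_at (sigma_a O i) (z - vec 1 0) P]
  | Upper i => [/\ 0 < z 0 0 < 1, 2^-1 < z 1 0 < 1 + 2^-1 &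
      point_at i z P \/ point_at (sigma_b O i) (z - vec 0 1) P]
  end.

(* In the charts c around P and c' around f P, the map f is z |-> A z + z0 near
   P; in particular f is smooth. *)
Definition affine_in_charts (A : 'M[R]_2) (f : surface -> surface) : Prop :=
  forall (c c' : chart) (P : surface) (z w : plane),
    chart_rel c P z -> chart_rel c' (f P) w ->
    exists z0 : plane, \forall u \near z, forall Q : surface,
      chart_rel c Q u -> chart_rel c' (f Q) (A *m u + z0).

(* A bijection f which is affine in the charts with an invertible linear part A
   is a diffeomorphism; as the differential of f in the charts is A, it
   preserves the orientation iff \det A > 0. *)
Definition veech_group : set 'M[R]_2 :=
  [set A | exists f : surface -> surface,
     [/\ bijective f, affine_in_charts A f & 0 < \det A]].

End Surface.

Arguments surface R {d} O.
Arguments veech_group R {d} O.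

Section Congruence.
Variable R : realType.

Definition SL2Z : set 'M[R]_2 :=
  map_mx intr @` [set B : 'M[int]_2 | \det B = 1].

Definition principal_congruence (n : nat) : set 'M[R]_2 :=
  map_mx intr @` [set B : 'M[int]_2 | \det B = 1 /\
     forall i j, (B i j = (1%:M : 'M[int]_2) i j %[mod n%:Z])%Z].

Definition subgroup_SL2Z (G : set 'M[R]_2) : Prop :=
  [/\ G `<=` SL2Z, G 1%:M,
      forall A B, G A -> G B -> G (A *m B) &
      forall A, G A -> G (invmx A)].

Definition congruence_group (G : set 'M[R]_2) : Prop :=
  subgroup_SL2Z G /\
  exists2 n : nat, (0 < n)%N & principal_congruence n `<=` G.

Definition noncongruence_group (G : set 'M[R]_2) : Prop :=
  subgroup_SL2Z G /\ ~ congruence_group G.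

End Congruence.

(* 'I_5 carries the ring structure of Z/5, in which the square 5 is the class
   5 = 0 and the squares 1, ..., 4 are the other classes. *)
Definition fun_a : 'I_5 -> 'I_5 := [eta id with 1 |-> 2, 2 |-> 3, 3 |-> 1].
Definition fun_b : 'I_5 -> 'I_5 :=
  [eta id with 1 |-> 4, 4 |-> 5, 5 |-> 1, 2 |-> 3, 3 |-> 2].

Lemma I5_cases (P : 'I_5 -> Prop) :
  P 1 -> P 2 -> P 3 -> P 4 -> P 5 -> forall i, P i.
Proof.
move=> h1 h2 h3 h4 h5 [[|[|[|[|[|//]]]]] lt_i].
- by move: h5; congr P; apply: val_inj.
- by move: h1; congr P; apply: val_inj.
- by move: h2; congr P; apply: val_inj.
- by move: h3; congr P; apply: val_inj.
- by move: h4; congr P; apply: val_inj.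
Qed.

Lemma fun_a_inj : injective fun_a.
Proof. by move=> i j; move: i j; do 2! apply: I5_cases. Qed.

Lemma fun_b_inj : injective fun_b.
Proof. by move=> i j; move: i j; do 2! apply: I5_cases. Qed.

Definition D_a : 'S_5 := perm fun_a_inj.
Definition D_b : 'S_5 := perm fun_b_inj.

Lemma D_transitive : [transitive <<[set D_a; D_b]%SET>>, on [set: 'I_5]%SET | 'P].
Proof.
have a12 : D_a 1 = 2 by rewrite permE.
have a23 : D_a 2 = 3 by rewrite permE.
have b14 : D_b 1 = 4 by rewrite permE.
have b45 : D_b 4 = 5 by rewrite permE.
set G := <<_>>%g.
have Ga : D_a \in G by rewrite mem_gen // !inE eqxx.
have Gb : D_b \in G by rewrite mem_gen // !inE eqxx orbT.
apply/imsetP; exists 1; rewrite ?inE //; apply/esym/setP => i; rewrite [RHS]inE.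
have orbS g x : g \in G -> x \in orbit 'P G 1%R -> g x \in orbit 'P G 1%R.
  by move=> Gg /orbitP[h Gh <-]; apply/orbitP; exists (h * g)%g;
     rewrite ?groupM //= !apermE permM.
have o1 : 1 \in orbit 'P G 1%R 
  by apply/orbitP; exists 1%g; [exact: group1|by rewrite /= /aperm perm1].
have o2 := orbS _ _ Ga o1; rewrite a12 in o2.
have o3 := orbS _ _ Ga o2; rewrite a23 in o3.
have o4 := orbS _ _ Gb o1; rewrite b14 in o4.
have o5 := orbS _ _ Gb o4; rewrite b45 in o5.
by move: i; apply: I5_cases.
Qed.

Definition D : origami 5 := Origami D_transitive.

(* Main.v *)
(* Every point of X^* has a unique position (i, z), with z in [0,1)^2 minus the
   origin, and "translate P v" moves P by a small vector v; a map f is affine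
   with linear part A iff f (translate P v) = translate (f P) (A v) for small v.
   The shear with matrix [[1, k], [0, 1]] is an affine map from the origami (a, b)
   to (a, b o a^-k), and symmetrically for lower triangular shears.

   Affine maps send closed geodesics to closed geodesics, and the vector of a
   closed geodesic is integral.  In D the square 4 carries a closed geodesic with
   vector (1, 0); in the sheared origami (a, b o a^-1) the square 3 carries one
   with vector (0, 1), which comes from the vector (-1, 1) in D.  So the linear
   part of an affine automorphism of D, and its inverse, have integer entries.

   Suppose that the Veech group contains Gamma(n), where n = 2^k m with m odd, and
   let x = 4^k, y = 6 m.  Since n | x y, the commutator of the upper shear by x and
   the lower shear by y lies in Gamma(n).  It maps D to an origami whose a is a
   5-cycle: the orders of a, b and b o a are 3, 6 and 4, while x = 1 mod 3, 6 | y and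
   y = 2 mod 4.  If the commutator were in the Veech group of D, there would be an
   affine map with linear part 1 from this origami to D, in which all horizontal
   geodesics close up after time 3. *)
Require Import Defs.
From mathcomp Require Import all_boot all_order all_algebra all_fingroup.
From mathcomp Require Import generic_quotient.
From mathcomp Require Import all_classical all_reals all_analysis.
From mathcomp Require Import ring lra zify.
Import numFieldNormedType.Exports.

Set Implicit Arguments.
Unset Strict Implicit.
Unset Printing Implicit Defensive.

Import Order.TTheory GRing.Theory Num.Theory.

Local Open Scope ring_scope.
Local Open Scope classical_set_scope.

(** * Integer powers in a finite group *)

Definition zpow (gT : finGroupType) (s : gT) (m : int) : gT :=
  match m with Posz n => (s ^+ n)%g | Negz n => (s ^- n.+1)%g end.

Lemma zpowS (gT : finGroupType) (s : gT) (m : int) :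
  zpow s (m + 1) = (zpow s m * s)%g.
Proof.
case: m => [n|[|n]]; rewrite /zpow.
- have -> : Posz n + 1 = n.+1 by lia.
  by rewrite /= expgSr.
- by rewrite /= expg1 mulVg.
- have -> : Negz n.+1 + 1 = Negz n by rewrite !NegzE; lia.
  by rewrite /= [in RHS]expgS invMg mulgKV.
Qed.

Lemma zpowB1 (gT : finGroupType) (s : gT) (m : int) :
  zpow s (m - 1) = (zpow s m * s^-1)%g.
Proof. by rewrite -{2}(subrK 1 m) zpowS mulgK. Qed.

Lemma zpowD (gT : finGroupType) (s : gT) (m n : int) :
  zpow s (m + n) = (zpow s m * zpow s n)%g.
Proof.
elim/int_ind: n => [|n IH|n IH].
- by rewrite addr0 mulg1.
- have -> : Posz n.+1 = n%:Z + 1 by lia.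
  by rewrite addrA !zpowS IH mulgA.
- have -> : - Posz n.+1 = - n%:Z - 1 by lia.
  by rewrite addrA !zpowB1 IH mulgA.
Qed.

Lemma zpowN (gT : finGroupType) (s : gT) (m : int) :
  zpow s (- m) = ((zpow s m)^-1)%g.
Proof.
by apply: (@mulIg _ (zpow s m)); rewrite mulVg -zpowD addNr.
Qed.

Lemma mem_zpow (gT : finGroupType) (G : {group gT}) (s : gT) (m : int) :
  s \in G -> zpow s m \in G.
Proof. by case: m => n Gs /=; rewrite ?groupV groupX. Qed.

Lemma zpowDx (d : nat) (s : 'S_d) (m n : int) (i : 'I_d) :
  zpow s (m + n) i = zpow s m (zpow s n i).
Proof. by rewrite addrC zpowD permM. Qed.

Lemma zpow0x (d : nat) (s : 'S_d) (i : 'I_d) : zpow s 0 i = i.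
Proof. by rewrite /= perm1. Qed.

(** * Floors and plane vectors *)

Lemma floorE (R : realType) (x : R) (m : int) :
  m%:~R <= x -> x < m%:~R + 1 -> Num.floor x = m.
Proof. by move=> mx xm; apply: floor_def; rewrite mx intrD. Qed.

Lemma vecx (R : realType) (x y : R) : vec x y 0 0 = x.
Proof. by rewrite mxE. Qed.

Lemma vecy (R : realType) (x y : R) : vec x y 1 0 = y.
Proof. by rewrite mxE. Qed.

Lemma mulmx_col2 (R : realType) (A : 'M[R]_2) (v : 'cV[R]_2) (i : 'I_2) :
  (A *m v) i 0 = A i 0 * v 0 0 + A i 1 * v 1 0.
Proof.
rewrite mxE big_ord_recl big_ord1; congr (_ * _ + A i _ * v _ _); exact: val_inj.
Qed.

(** * Neighbourhoods of the origin in the plane *)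

Section Near.
Variable R : realType.
Implicit Types (P Q : 'cV[R]_2 -> Prop) (z v : 'cV[R]_2).

(** Square boxes rather than Euclidean discs: [ball] on matrices is entrywise, so this is the
    neighbourhood filter of 0 in explicit form. *)
Definition near0 P := exists2 e : R, 0 < e &
  forall v, `|v 0 0| < e -> `|v 1 0| < e -> P v.

Lemma near0E z P : (\forall u \near z, P u) <-> near0 (fun v => P (z + v)).
Proof.
split.
- case/nbhs_ballP => e /= e0 h; exists e => // v v0 v1; apply: h.
  split=> // i j; rewrite (ord1 j) /ball /= !mxE opprD addNKr normrN.
  by case: i => [[|[|//]] ?]; [move: v0|move: v1]; congr (`|v _ _| < e);
     apply: val_inj.
- case=> e e0 h; apply/nbhs_ballP; exists e => //= u [_ hu].
  rewrite -(subrK z u) addrC; apply: h; rewrite !mxE distrC; exact: hu.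
Qed.

Lemma near0_0 P : near0 P -> P 0.
Proof. by case=> e e0; apply; rewrite mxE normr0. Qed.

Lemma near0_mono P Q : (forall v, P v -> Q v) -> near0 P -> near0 Q.
Proof. by move=> PQ [e e0 h]; exists e => // v v0 v1; apply/PQ/h. Qed.

Lemma near0_and P Q : near0 P -> near0 Q -> near0 (fun v => P v /\ Q v).
Proof.
move=> [e e0 he] [g g0 hg]; exists (Num.min e g); first by rewrite lt_min e0.
by move=> v; rewrite !lt_min => /andP[? ?] /andP[? ?]; split; [apply: he|apply: hg].
Qed.

Lemma near0_mul (A : 'M[R]_2) P : near0 P -> near0 (fun v => P (A *m v)).
Proof.
case=> e e0 h.
(* The summand 1 keeps [C] positive when [A = 0] and makes both row sums strictly smaller than
   [C]. *)
pose C := 1 + (`|A 0 0| + `|A 0 1| + `|A 1 0| + `|A 1 1|).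
have C0 : 0 < C by rewrite ltr_pwDl // !addr_ge0.
exists (e / C); first by rewrite divr_gt0.
have bound (i : 'I_2) v : `|A i 0| + `|A i 1| < C ->
    `|v 0 0| < e / C -> `|v 1 0| < e / C -> `|(A *m v) i 0| < e.
  move=> iC v0 v1; rewrite mulmx_col2; apply: le_lt_trans (ler_normD _ _) _.
  rewrite !normrM.
  have eC : 0 < e / C by rewrite divr_gt0.
  have -> : e = C * (e / C) by rewrite mulrC divfK // gt_eqF.
  apply: (@le_lt_trans _ _ ((`|A i 0| + `|A i 1|) * (e / C))).
    by rewrite mulrDl lerD // ler_wpM2l // ltW.
  by rewrite ltr_pM2r.
by move=> v v0 v1; apply: h; apply: bound => //; rewrite /C;
  have := normr_ge0 (A 0 0); have := normr_ge0 (A 0 1);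
  have := normr_ge0 (A 1 0); have := normr_ge0 (A 1 1); lra.
Qed.

Lemma near0_itv (i : 'I_2) (a x b : R) :
  a < x -> x < b -> near0 (fun v => a < x + v i 0 < b).
Proof.
move=> ax xb; exists (Num.min (x - a) (b - x)); first by rewrite lt_min !subr_gt0 ax.
have key (t : R) : `|t| < Num.min (x - a) (b - x) -> a < x + t < b.
  by rewrite lt_min !ltr_norml => /andP[/andP[? ?] /andP[? ?]]; lra.
move=> v v0 v1; apply: key.
by case: i => [[|[|//]] ?]; [move: v0|move: v1]; congr (`|v _ _| < _); apply: val_inj.
Qed.

Lemma near0_line z P : near0 P ->
  exists2 e : R, 0 < e & forall s, `|s| < e -> P (s *: z).
Proof.
case=> e e0 h; pose C := 1 + (`|z 0 0| + `|z 1 0|).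
have C0 : 0 < C by rewrite ltr_pwDl // !addr_ge0.
exists (e / C); first by rewrite divr_gt0.
move=> s sC; have sCe : `|s| * C < e by rewrite -ltr_pdivlMr.
have s0 := normr_ge0 s; have z0 := normr_ge0 (z 0 0); have z1 := normr_ge0 (z 1 0).
by apply: h; rewrite mxE normrM; apply: le_lt_trans sCe; rewrite ler_wpM2l // /C; lra.
Qed.

(* R is connected: the set where P holds is open and closed. *)
Lemma locally_constant (P : R -> Prop) :
  (forall t, exists2 e : R, 0 < e & forall s, `|s| < e -> (P (t + s) <-> P t)) ->
  P 0 -> forall t, P t.
Proof.
move=> loc P0 t.
have op (Q : R -> Prop) : (forall t, exists2 e : R, 0 < e &
    forall s, `|s| < e -> (Q (t + s) <-> Q t)) -> open [set t | Q t].
  move=> locQ; rewrite openE => u /= Qu; apply/nbhs_ballP.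
  have [e e0 h] := locQ u; exists e => //= w; rewrite /ball /= distrC => uw.
  by have := h _ uw; rewrite addrC subrK => ->.
have cR : connected [set: R] by apply/connected_intervalP.
suff E : [set t | P t] = setT by have : [set: R] t by []; rewrite -E.
apply: cR; first by exists 0.
- by exists [set t | P t]; rewrite ?setTI //; apply: op.
- exists [set t | P t]; rewrite ?setTI //; rewrite -openC.
  by apply: (op (fun t => ~ P t)) => u; have [e e0 h] := loc u; exists e => // s /h ->.
Qed.

End Near.

(** Turns the list of vertex coordinates into integrality, which is invariant under integral
    translations; this links [punctured_square] to [off_lattice]. *)
Lemma in01_int (R : realType) (x : R) :
  0 <= x <= 1 -> (x \is a Num.int) = (x \in [:: 0; 1]).
Proof.
move=> /andP[x0 x1]; rewrite !inE; apply/idP/orP => [/intrP[m xm]|[]/eqP-> //].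
move: x0 x1; rewrite {x}xm ler0z lerz1 => m0 m1.
have [->|->] : m = 0 \/ m = 1 by lia.
- by left.
- by right.
Qed.

Lemma cell_int (R : realType) (x : R) :
  0 <= x < 1 -> x \is a Num.int -> x = 0.
Proof.
move=> /andP[x0 x1]; rewrite in01_int ?x0 ?ltW // !inE => /orP[]/eqP // x_1.
by rewrite x_1 ltxx in x1.
Qed.

Lemma int_small (R : realType) (x : R) :
  x \is a Num.int -> -1 < x -> x < 1 -> x = 0.
Proof.
move=> /intrP[m ->]; rewrite -[-1](intrN _ 1) ltr_int ltrz1 => ? ?.
by have -> : m = 0 by lia.
Qed.

(** * Points of the surface as positions in half-open squares *)

Section Coordinates.
Variables (R : realType) (d : nat) (O : origami d).
Local Notation plane := 'cV[R]_2.
Local Notation a := (sigma_a O).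
Local Notation b := (sigma_b O).
Implicit Types (p : 'I_d * plane) (P : surface R O) (z v : plane) (i : 'I_d).

(* The position reached from the square i by the vector z; this is the developing
   map only if z stays in the unit strip 0 <= x < 1 or 0 <= y < 1, since a and b
   need not commute. *)
Definition wrap p : 'I_d * plane :=
  let m := Num.floor (p.2 0 0) in let n := Num.floor (p.2 1 0) in
  (zpow b n (zpow a m p.1), p.2 - vec m%:~R n%:~R).

Arguments wrap : simpl never.

Definition off_lattice z : bool :=
  ~~ ((z 0 0 \is a Num.int) && (z 1 0 \is a Num.int)).

Definition in_cell z : bool := (0 <= z 0 0 < 1) && (0 <= z 1 0 < 1).

Lemma wrapE i z (m n : int) :
  m%:~R <= z 0 0 < m%:~R + 1 -> n%:~R <= z 1 0 < n%:~R + 1 ->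
  wrap (i, z) = (zpow b n (zpow a m i), z - vec m%:~R n%:~R).
Proof.
move=> /andP[? ?] /andP[? ?].
by rewrite /wrap /= (@floorE _ (z 0 0) m) // (@floorE _ (z 1 0) n).
Qed.

Lemma wrap_cell p : in_cell (wrap p).2.
Proof.
have h (x : R) : 0 <= x - (Num.floor x)%:~R < 1.
  by rewrite subr_ge0 floor_le ltrBlDl; have := floorD1_gt x; rewrite intrD.
by rewrite /in_cell /wrap !mxE /= !h.
Qed.

Lemma wrap_id p : in_cell p.2 -> wrap p = p.
Proof.
case: p => i z /andP[/= z0 z1]; rewrite (@wrapE _ _ 0 0) ?add0r // !zpow0x.
by congr (_, _); apply: plane_eq; rewrite !mxE /= subr0.
Qed.

Lemma off_lattice_wrap p : off_lattice (wrap p).2 = off_lattice p.2.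
Proof. by rewrite /off_lattice /wrap !mxE /= !rpredBr ?intr_int. Qed.

Lemma cell_punctured z : in_cell z -> off_lattice z -> punctured_square z.
Proof.
move=> /andP[/andP[x0 x1] /andP[y0 y1]]; rewrite /off_lattice !in01_int ?x0 ?y0 ?ltW //.
by rewrite /punctured_square x0 y0 !ltW.
Qed.

Lemma punctured_off_lattice z : punctured_square z -> off_lattice z.
Proof. by case/and3P=> x01 y01; rewrite /off_lattice !in01_int. Qed.

Lemma glued_wrap (p : square_point R d) :
  exists2 q : square_point R d, val q = wrap (val p) & glued O p q.
Proof.
have [q vq] : exists q : square_point R d, val q = wrap (val p).
  have hq : punctured_square (wrap (val p)).2.
    by apply: cell_punctured (wrap_cell _) _; rewrite off_lattice_wrap;
       apply: punctured_off_lattice (valP p).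
  by exists (Sub (wrap (val p)) hq).
exists q => //; rewrite /glued /glue_right /glue_upper vq.
have hp : punctured_square (val p).2 := valP p.
case vp: (val p) hp vq => [i z] hp vq; rewrite /= in hp.
case/and3P: hp => [/andP[x0 x1] /andP[y0 y1] nv].
have := x1; rewrite le_eqVlt => /orP[/eqP x_1|{}x1].
  have {}y1 : z 1 0 < 1.
    by rewrite lt_neqAle y1 andbT; apply: contra nv => /eqP->; rewrite x_1 !inE eqxx orbT.
  have -> : wrap (i, z) = (a i, z - vec 1 0).
    by rewrite (@wrapE _ _ 1 0) ?add0r ?x_1 ?lexx ?y0 ?ltrDl //= ?perm1 ?expg1.
  by rewrite /= x_1 !mxE /= x_1 subrr subr0 !eqxx /= orbT.
have := y1; rewrite le_eqVlt => /orP[/eqP y_1|{}y1].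
  have -> : wrap (i, z) = (b i, z - vec 0 1).
    by rewrite (@wrapE _ _ 0 1) ?add0r ?y_1 ?lexx ?x0 ?ltrDl //= ?perm1 ?expg1.
  by rewrite /= y_1 !mxE /= y_1 subrr subr0 !eqxx /= !orbT.
apply/orP; left; apply/eqP/val_inj; rewrite vq vp wrap_id //.
by rewrite /in_cell /= x0 x1 y0.
Qed.

(** Together with [glued_wrap] this makes [wrap] a complete invariant of the gluing classes. *)
Lemma glued_wrap_eq (p q : square_point R d) :
  glued O p q -> wrap (val p) = wrap (val q).
Proof.
have right (p1 p2 : square_point R d) : glue_right O p1 p2 -> wrap (val p1) = wrap (val p2).
  case: p1 p2 => -[i z] /= h [[j w] /= h'] /and4P[/= /eqP -> /eqP x1 /eqP x0 /eqP y].
  have /and3P[_ /andP[y0 y1] nv] := h; have {}y1 : z 1 0 < 1.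
    by rewrite lt_neqAle y1 andbT; apply: contra nv => /eqP->; rewrite x1 !inE eqxx orbT.
  rewrite (@wrapE i z 1 0) ?add0r ?x1 ?lexx ?y0 ?ltrDl //= wrap_id /=; last first.
    by rewrite /in_cell /= x0 y lexx ltr01 y0 y1.
  by rewrite expg1 perm1; congr (_, _); apply: plane_eq; rewrite !mxE /= ?x1 ?x0 ?y ?subrr ?subr0.
have upper (p1 p2 : square_point R d) : glue_upper O p1 p2 -> wrap (val p1) = wrap (val p2).
  case: p1 p2 => -[i z] /= h [[j w] /= h'] /and4P[/= /eqP -> /eqP x1 /eqP x0 /eqP y].
  have /and3P[/andP[y0 y1] _ nv] := h; have {}y1 : z 0 0 < 1.
    by rewrite lt_neqAle y1 andbT; apply: contra nv => /eqP->; rewrite x1 !inE eqxx orbT.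
  rewrite (@wrapE i z 0 1) ?add0r ?x1 ?lexx ?y0 ?ltrDl //= wrap_id /=; last first.
    by rewrite /in_cell /= x0 y lexx ltr01 y0 y1.
  by rewrite expg1 perm1; congr (_, _); apply: plane_eq; rewrite !mxE /= ?x1 ?x0 ?y ?subrr ?subr0.
rewrite /glued => /orP[/eqP-> //|/or4P[] /[dup] h].
- exact: right.
- by move/right.
- exact: upper.
- by move/upper.
Qed.

Lemma center_punctured i : punctured_square (i, vec 2^-1 2^-1 : plane).2.
Proof.
apply: cell_punctured; first by rewrite /in_cell !mxE /=; apply/andP; split; lra.
rewrite /off_lattice !mxE /= andbb; apply/negP => /cell_int H.
by have := H ltac:(lra); lra.
Qed.

(* Junk value: the centre of the square when p is not a point of a punctured square. *)
Definition pt p : surface R O :=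
  (\pi_(surface R O) (insubd (Sub (p.1, vec 2^-1 2^-1) (center_punctured p.1)) p))%qT.

(** The chosen representative does not matter, by [glued_wrap_eq]; [pt] recovers the point from this
    position. *)
Definition coord P : 'I_d * plane := wrap (val (repr P)).

Lemma coord_cell P : in_cell (coord P).2. Proof. exact: wrap_cell. Qed.

Lemma coord_off_lattice P : off_lattice (coord P).2.
Proof. by rewrite off_lattice_wrap; apply: punctured_off_lattice (valP (repr P)). Qed.

Lemma coord_pi (q : square_point R d) : coord (\pi_(surface R O) q)%qT = wrap (val q).
Proof.
apply: glued_wrap_eq; apply/eqmodP; exact: reprK.
Qed.

Lemma pt_val (q : square_point R d) : pt (val q) = (\pi_(surface R O) q)%qT.
Proof. by rewrite /pt valKd. Qed.

Lemma coordK P : pt (coord P) = P.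
Proof.
rewrite /coord; have [q <- /eqmodP pq] := glued_wrap (repr P).
by rewrite pt_val -pq reprK.
Qed.

Lemma coord_pt p : in_cell p.2 -> off_lattice p.2 -> coord (pt p) = p.
Proof.
move=> p_cell p_off; have h := cell_punctured p_cell p_off.
have -> : p = val (Sub p h : square_point R d) by [].
by rewrite pt_val coord_pi wrap_id.
Qed.

Lemma coord_inj : injective coord.
Proof. exact: can_inj coordK. Qed.

Lemma coord_wrap p : off_lattice p.2 -> coord (pt (wrap p)) = wrap p.
Proof. by move=> hp; rewrite coord_pt ?wrap_cell ?off_lattice_wrap. Qed.

Lemma point_atE i z P :
  point_at i z P <-> punctured_square z /\ P = pt (wrap (i, z)).
Proof.
split=> [[q vq <-]|[hz ->]].
  split; first by have := valP q; rewrite vq.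
  by apply: coord_inj; rewrite coord_wrap -vq ?coord_pi //;
     apply: punctured_off_lattice (valP q).
exists (Sub (i, z) hz) => //.
by apply: coord_inj; rewrite coord_wrap ?coord_pi //; apply: punctured_off_lattice.
Qed.

End Coordinates.

(** * Small translations and the charts of the translation structure *)

Section Charts.
Variables (R : realType) (d : nat) (O : origami d).
Local Notation plane := 'cV[R]_2.
Local Notation a := (sigma_a O).
Local Notation b := (sigma_b O).
Implicit Types (P Q : surface R O) (z v w : plane) (i : 'I_d) (c : chart d).

(** At height in [0,1) only powers of [a] enter [wrap], so a horizontal integral shift is absorbed
    in the label without commuting [a] and [b]. *)
Lemma wrap_shift_a i z (m : int) : Num.floor (z 1 0) = 0 ->
  wrap O (zpow a m i, z - vec m%:~R 0) = wrap O (i, z).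
Proof.
move=> y0; rewrite /wrap /= !mxE /= subr0 y0 !zpow0x.
have -> : Num.floor (z 0 0 - m%:~R) = Num.floor (z 0 0) - m.
  by rewrite -intrN floorDrz ?intr_int // intrKfloor.
rewrite -zpowDx subrK; congr (_, _).
by apply: plane_eq; rewrite !mxE /= ?intrB ?subr0 //; ring.
Qed.

Lemma wrap_shift_b i z (n : int) : Num.floor (z 0 0) = 0 ->
  wrap O (zpow b n i, z - vec 0 n%:~R) = wrap O (i, z).
Proof.
move=> x0; rewrite /wrap /= !mxE /= subr0 x0 !zpow0x.
have -> : Num.floor (z 1 0 - n%:~R) = Num.floor (z 1 0) - n.
  by rewrite -intrN floorDrz ?intr_int // intrKfloor.
rewrite -zpowDx subrK; congr (_, _).
by apply: plane_eq; rewrite !mxE /= ?intrB ?subr0 //; ring.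
Qed.

(** Two such points are developed from one square by powers of a single permutation, so the
    displacement between them is unambiguous. *)
Definition same_strip z w : Prop :=
  (Num.floor (z 1 0) = 0 /\ Num.floor (w 1 0) = 0) \/
  (Num.floor (z 0 0) = 0 /\ Num.floor (w 0 0) = 0).

(* Meaningful for small v only. *)
Definition translate P v : surface R O :=
  pt O (wrap O ((coord P).1, (coord P).2 + v)).

(** Normalizing the starting point changes the label by a power of one permutation and subtracts an
    integral vector; the shift lemmas for the common strip undo both. *)
Lemma translate_wrap i z w : off_lattice z -> same_strip z w ->
  translate (pt O (wrap O (i, z))) (w - z) = pt O (wrap O (i, w)).
Proof.
move=> z_off zw; rewrite /translate coord_wrap //.
case: zw => -[z0 w0].
  rewrite [X in (X.1, X.2 + _)]/wrap /= z0 zpow0x -(@wrap_shift_a i w (Num.floor (z 0 0))) //.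
  by congr (pt _ (wrap _ (_, _))); apply: plane_eq; rewrite !mxE /=; ring.
rewrite [X in (X.1, X.2 + _)]/wrap /= z0 zpow0x -(@wrap_shift_b i w (Num.floor (z 1 0))) //.
by congr (pt _ (wrap _ (_, _))); apply: plane_eq; rewrite !mxE /=; ring.
Qed.

Definition chart_square c : 'I_d :=
  match c with Inner i => i | Right i => i | Upper i => i end.

Definition chart_dom c z : Prop :=
  match c with
  | Inner _ => 0 < z 0 0 < 1 /\ 0 < z 1 0 < 1
  | Right _ => 2^-1 < z 0 0 < 1 + 2^-1 /\ 0 < z 1 0 < 1
  | Upper _ => 0 < z 0 0 < 1 /\ 2^-1 < z 1 0 < 1 + 2^-1
  end.

Lemma floor_in01 (x : R) : 0 < x < 1 -> Num.floor x = 0.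
Proof.
move=> /andP[x0 x1]; apply: floorE; rewrite /= ?add0r //; exact: ltW.
Qed.

Lemma nint_in01 (x : R) : 0 < x < 1 -> (x \is a Num.int) = false.
Proof.
move=> /andP[x0 x1]; apply/negP => /cell_int H.
by have := x0; rewrite H ?ltxx // ltW.
Qed.

Lemma chart_dom_off_lattice c z : chart_dom c z -> off_lattice z.
Proof.
by rewrite /off_lattice; case: c => i /= [h1 h2];
  [rewrite nint_in01 | rewrite andbC nint_in01 | rewrite nint_in01].
Qed.

Lemma chart_dom_strip c z w : chart_dom c z -> chart_dom c w -> same_strip z w.
Proof.
by case: c => i /= [h1 h2] [k1 k2]; [left|left|right]; split; apply: floor_in01.
Qed.

Lemma chart_dom_near c z : chart_dom c z -> near0 (fun v => chart_dom c (z + v)).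
Proof.
by case: c => i /= [/andP[? ?] /andP[? ?]];
  (apply: near0_mono (near0_and (near0_itv _ _ _) (near0_itv _ _ _));
   first by move=> v; rewrite !mxE => h; exact: h).
Qed.

(** All three kinds of chart invert the same development [pt (wrap (i, z))], on different boxes.
    This uniform description replaces the case analysis on charts from here on. *)
Lemma chart_relE c P z :
  chart_rel c P z <-> chart_dom c z /\ P = pt O (wrap O (chart_square c, z)).
Proof.
case: c => i /=.
- split=> [[h1 h2 /point_atE[_ ->]] //|[[h1 h2] ->]]; split=> //; apply/point_atE; split=> //.
  apply: cell_punctured; last by rewrite /off_lattice nint_in01.
  by move/andP: h1 => [? x1]; move/andP: h2 => [? y1]; rewrite /in_cell x1 y1 !ltW.
- have shift z' : 0 < z' 1 0 < 1 -> wrap O (a i, z' - vec 1 0) = wrap O (i, z').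
    by move=> h; rewrite -(@wrap_shift_a i z' 1) ?floor_in01 //= expg1.
  split=> [[h1 h2 [/point_atE[_ ->] //|/point_atE[_ ->]]]|[[h1 h2] ->]].
    by rewrite shift.
  have hp w : 0 <= w 0 0 <= 1 -> 0 < w 1 0 < 1 -> punctured_square w.
    move=> w0 w1; rewrite /punctured_square w0 -(in01_int (x := w 1 0)) ?nint_in01 ?andbF //.
      by case/andP: w1 => ? ?; rewrite !ltW.
    by case/andP: w1 => ? ?; rewrite !ltW.
  split=> //; case/andP: h1 => x0 x1.
  (* Up to and including the common edge the point is taken in the square [i], beyond it in
     [a i]. *)
  case: (lerP (z 0 0) 1) => hx; [left|right]; apply/point_atE.
    by split=> //; apply: hp => //; rewrite hx andbT; lra.
  split; last by rewrite shift.
  by apply: hp; rewrite !mxE /= ?subr0 //; apply/andP; split; lra.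
- have shift z' : 0 < z' 0 0 < 1 -> wrap O (b i, z' - vec 0 1) = wrap O (i, z').
    by move=> h; rewrite -(@wrap_shift_b i z' 1) ?floor_in01 //= expg1.
  split=> [[h1 h2 [/point_atE[_ ->] //|/point_atE[_ ->]]]|[[h1 h2] ->]].
    by rewrite shift.
  have hp w : 0 < w 0 0 < 1 -> 0 <= w 1 0 <= 1 -> punctured_square w.
    move=> w0 w1; rewrite /punctured_square w1 -(in01_int (x := w 0 0)) ?nint_in01 //=.
      by case/andP: w0 => ? ?; rewrite !ltW.
    by case/andP: w0 => ? ?; rewrite !ltW.
  split=> //; case/andP: h2 => y0 y1.
  case: (lerP (z 1 0) 1) => hy; [left|right]; apply/point_atE.
    by split=> //; apply: hp => //; rewrite hy andbT; lra.
  split; last by rewrite shift.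
  by apply: hp; rewrite !mxE /= ?subr0 //; apply/andP; split; lra.
Qed.

Lemma chart_exists P : exists c z, chart_rel c P z.
Proof.
have := coord_cell P; have := coord_off_lattice P.
rewrite -{3}(coordK P); case: (coord P) => i z /= z_off z_cell.
have /andP[/andP[x0 x1] /andP[y0 y1]] := z_cell.
have [x_0|nx0] := eqVneq (z 0 0) 0.
  have yp : 0 < z 1 0 < 1.
    rewrite y1 lt_neqAle y0 !andbT eq_sym; apply: contraNneq z_off => y_0.
    by rewrite /off_lattice x_0 y_0 !int_num0.
  (* A point of the left edge of [i] lies on the right edge of the preceding square, whose edge
     chart contains it. *)
  exists (Right (zpow a (- 1) i)), (z + vec 1 0); apply/chart_relE; split.
    by rewrite /= !mxE /= x_0 addr0; split => //; apply/andP; split; lra.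
  rewrite /= -(@wrap_shift_a _ _ 1) ?mxE /= ?addr0 ?floor_in01 //.
  by rewrite addrK -(permM _ a) expg1 mulVg perm1 wrap_id.
have [y_0|ny0] := eqVneq (z 1 0) 0.
  have xp : 0 < z 0 0 < 1 by rewrite x1 lt_neqAle x0 eq_sym nx0.
  exists (Upper (zpow b (- 1) i)), (z + vec 0 1); apply/chart_relE; split.
    by rewrite /= !mxE /= y_0 addr0; split => //; apply/andP; split; lra.
  rewrite /= -(@wrap_shift_b _ _ 1) ?mxE /= ?addr0 ?floor_in01 //.
  by rewrite addrK -(permM _ b) expg1 mulVg perm1 wrap_id.
exists (Inner i), z; apply/chart_relE; rewrite /= wrap_id //.
by rewrite x1 y1 !lt_neqAle x0 y0 !(eq_sym 0) nx0 ny0.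
Qed.

Lemma wrap_eq_int (p q : 'I_d * plane) : wrap O p = wrap O q ->
  (p.2 - q.2) 0 0 \is a Num.int /\ (p.2 - q.2) 1 0 \is a Num.int.
Proof.
case=> _ e.
have -> : p.2 - q.2 = vec (Num.floor (p.2 0 0))%:~R (Num.floor (p.2 1 0))%:~R
    - vec (Num.floor (q.2 0 0))%:~R (Num.floor (q.2 1 0))%:~R.
  by apply/eqP; rewrite subr_eq -addrA [- _ + q.2]addrC -e addrC subrK.
by rewrite !mxE /= !rpredB ?intr_int.
Qed.

(** Two coordinates of one point differ by an integral vector, and each chart domain is an open box
    with sides of length 1, so the difference is 0. *)
Lemma chart_rel_inj c P z w : chart_rel c P z -> chart_rel c P w -> z = w.
Proof.
move=> /chart_relE[hz ->] /chart_relE[hw].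
move=> /(congr1 (@coord _ _ _)); rewrite !coord_wrap ?(chart_dom_off_lattice hz)
  ?(chart_dom_off_lattice hw) // => /wrap_eq_int/= [x_int y_int].
apply/eqP; rewrite -subr_eq0; apply/eqP; apply: plane_eq; rewrite [RHS]mxE;
  [apply: int_small x_int _ _ | apply: int_small y_int _ _]; rewrite !mxE;
  by case: c hz hw => i /= [/andP[? ?] /andP[? ?]] [/andP[? ?] /andP[? ?]]; lra.
Qed.

Lemma translate_chart c P z v : chart_rel c P z -> chart_dom c (z + v) ->
  chart_rel c (translate P v) (z + v).
Proof.
move=> /chart_relE[hz ->] hw; apply/chart_relE; split=> //.
rewrite -{1}(addKr z v) addrC; apply: translate_wrap.
  exact: chart_dom_off_lattice hz.
exact: chart_dom_strip hz hw.
Qed.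

End Charts.

(** * Explicit two by two matrices *)

Definition mx2 (T : Type) (p q r s : T) : 'M[T]_2 :=
  \matrix_(i, j) (if i == 0 then (if j == 0 then p else q)
                  else (if j == 0 then r else s)).

Definition shear (T : nzRingType) (k : T) : 'M[T]_2 := mx2 1 k 0 1.
Definition swap (T : nzRingType) : 'M[T]_2 := mx2 0 1 1 0.

Lemma mx2_eta (T : Type) (A : 'M[T]_2) : A = mx2 (A 0 0) (A 0 1) (A 1 0) (A 1 1).
Proof.
apply/matrixP => -[[|[|//]] i] [[|[|//]] j]; rewrite !mxE /=; congr (A _ _);
  exact: val_inj.
Qed.

Lemma mulmx2 (T : nzRingType) (p q r s p' q' r' s' : T) :
  mx2 p q r s *m mx2 p' q' r' s' =
  mx2 (p * p' + q * r') (p * q' + q * s') (r * p' + s * r') (r * q' + s * s').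
Proof. by rewrite [LHS]mx2_eta !mxE !big_ord_recl !big_ord0 !mxE /= !addr0. Qed.

Lemma det_mx2 (T : comNzRingType) (p q r s : T) : \det (mx2 p q r s) = p * s - q * r.
Proof.
rewrite (expand_det_row _ 0) !big_ord_recl big_ord0 /cofactor !det_mx11 !mxE /=.
by rewrite expr0 expr1 mul1r mulN1r addr0 mulrN.
Qed.

Lemma map_mx2 (T U : Type) (f : T -> U) (p q r s : T) :
  map_mx f (mx2 p q r s) = mx2 (f p) (f q) (f r) (f s).
Proof. by rewrite [LHS]mx2_eta !mxE. Qed.

(** * Affine maps between origamis, shears and the swap of the axes *)

Section AffineMaps.
Variables (R : realType) (d : nat).
Local Notation plane := 'cV[R]_2.
Implicit Types (O : origami d) (z v w : plane) (i : 'I_d).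

(** A chart-free form of [affine_in_charts], with a target that may differ from the source, so that
    a map can be factored through intermediate origamis. *)
Definition affine_map O O' (A : 'M[R]_2) (f : surface R O -> surface R O') : Prop :=
  forall P, near0 (fun v => f (translate P v) = translate (f P) (A *m v)).

(** The sign of the determinant is left free, so that [swap], of determinant -1, qualifies. *)
Definition affine_equiv O O' (A : 'M[R]_2) : Prop :=
  exists f : surface R O -> surface R O', bijective f /\ affine_map A f.

(** In a chart [translate] is addition of [v], and the constant [z0] is forced to be [w - A *m z];
    so both conditions compare the same points near [P]. *)
Lemma affine_in_chartsE O A (f : surface R O -> surface R O) :
  affine_in_charts A f <-> affine_map A f.
Proof.
split=> [fA P|fA c c' P z w hz hw].
- have [c [z hz]] := chart_exists P; have [c' [w hw]] := chart_exists (f P).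
  have [z0 /near0E near_z] := fA c c' P z w hz hw.
  have wE : A *m z + z0 = w.
    apply: (@chart_rel_inj _ _ _ c' (f P)) => //.
    by have := near0_0 near_z P; rewrite addr0; apply.
  have [domz _] := (chart_relE _ _ _).1 hz; have [domw _] := (chart_relE _ _ _).1 hw.
  apply: near0_mono (near0_and near_z (near0_and (chart_dom_near domz)
    (near0_mul A (chart_dom_near domw)))) => v [/(_ (translate P v)) h [hv hAv]].
  have := h (translate_chart hz hv); have := translate_chart hw hAv.
  have -> : w + A *m v = A *m (z + v) + z0 by rewrite -wE mulmxDr addrAC.
  by move=> /chart_relE[_ ->] /chart_relE[_ ->].
- exists (w - A *m z); apply/near0E.
  have [domz _] := (chart_relE _ _ _).1 hz; have [domw _] := (chart_relE _ _ _).1 hw.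
  apply: near0_mono (near0_and (fA P) (near0_and (chart_dom_near domz)
    (near0_mul A (chart_dom_near domw)))) => v [fv [hv hAv]] Q hQ.
  have -> : Q = translate P v.
    by move: (translate_chart hz hv) hQ => /chart_relE[_ ->] /chart_relE[_ ->].
  rewrite fv; have := translate_chart hw hAv; congr chart_rel.
  by rewrite mulmxDr [RHS]addrC addrA subrK.
Qed.

Lemma affine_equiv_refl O : affine_equiv O O 1%:M.
Proof.
exists id; split; first by exists id.
by move=> P; exists 1 => // v _ _; rewrite mul1mx.
Qed.

Lemma affine_equiv_comp O O' O'' A B :
  affine_equiv O O' A -> affine_equiv O' O'' B -> affine_equiv O O'' (B *m A).
Proof.
move=> [f [f_bij fA]] [g [g_bij gB]]; exists (g \o f); split; first exact: bij_comp.
move=> P; apply: near0_mono (near0_and (fA P) (near0_mul A (gB (f P)))) => v /=.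
by case=> -> ->; rewrite mulmxA.
Qed.

Lemma affine_equiv_inv O O' A :
  A \in unitmx -> affine_equiv O O' A -> affine_equiv O' O (invmx A).
Proof.
move=> uA [f [[g fK gK] fA]]; exists g; split; first by exists f.
move=> P; apply: near0_mono (near0_mul (invmx A) (fA (g P))) => v.
by rewrite gK mulKVmx // => <-; rewrite fK.
Qed.

(** Near a point of the first kind the development uses powers of [a] only, near one of the second
    kind powers of [b] only. The local checks for shears and swap follow this split. *)
Lemma cell_cases z : in_cell z -> off_lattice z ->
  0 < z 1 0 < 1 \/ 0 < z 0 0 < 1 /\ z 1 0 = 0.
Proof.
move=> /andP[/andP[x0 x1] /andP[y0 y1]] z_off.
have [y_0|ny0] := eqVneq (z 1 0) 0; last by left; rewrite y1 lt_neqAle y0 eq_sym ny0.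
right; split=> //; rewrite x1 lt_neqAle x0 !andbT eq_sym; apply: contraNneq z_off => x_0.
by rewrite /off_lattice x_0 y_0 !int_num0.
Qed.

Lemma near0_off_lattice z : in_cell z -> off_lattice z ->
  near0 (fun v => off_lattice (z + v)).
Proof.
move=> z_cell z_off; case: (cell_cases z_cell z_off) => [/andP[y0 y1]|[/andP[x0 x1] _]].
- apply: near0_mono (near0_itv 1 y0 y1) => v h.
  by rewrite /off_lattice andbC mxE nint_in01.
- apply: near0_mono (near0_itv 0 x0 x1) => v h.
  by rewrite /off_lattice mxE nint_in01.
Qed.

(** Applies [A] to each half-open square separately and develops the result in [O']; that the pieces
    fit along the edges has to be checked for each matrix. *)
Definition linear_map O O' (A : 'M[R]_2) (P : surface R O) : surface R O' :=
  pt O' (wrap O' ((coord P).1, A *m (coord P).2)).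

Arguments linear_map {O O'} A P.

Lemma linear_map_affine O O' (A : 'M[R]_2) :
  (forall z, off_lattice (A *m z) = off_lattice z) ->
  (forall i z, in_cell z -> off_lattice z -> near0 (fun v =>
     same_strip (A *m z) (A *m (z + v)) /\
     wrap O' ((wrap O (i, z + v)).1, A *m (wrap O (i, z + v)).2)
       = wrap O' (i, A *m (z + v)))) ->
  affine_map A (@linear_map O O' A).
Proof.
move=> A_off A_wrap P; have z_cell := coord_cell P; have z_off := coord_off_lattice P.
have := A_wrap (coord P).1 _ z_cell z_off.
move=> /(near0_and (near0_off_lattice z_cell z_off)); apply: near0_mono => v.
case=> zv_off [strip wrapE].
have -> : linear_map A (translate P v)
    = pt O' (wrap O' ((coord P).1, A *m ((coord P).2 + v))).
  by rewrite /linear_map /translate coord_wrap // wrapE.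
have {1}-> : A *m v = A *m ((coord P).2 + v) - A *m (coord P).2.
  by rewrite mulmxDr addrC addKr.
by rewrite /linear_map translate_wrap ?A_off.
Qed.

Lemma shearx (k : R) z : (shear k *m z) 0 0 = z 0 0 + k * z 1 0.
Proof. by rewrite mulmx_col2 !mxE /=; ring. Qed.

Lemma sheary (k : R) z : (shear k *m z) 1 0 = z 1 0.
Proof. by rewrite mulmx_col2 !mxE /=; ring. Qed.

Lemma swapx z : (swap R *m z) 0 0 = z 1 0.
Proof. by rewrite mulmx_col2 !mxE /=; ring. Qed.

Lemma swapy z : (swap R *m z) 1 0 = z 0 0.
Proof. by rewrite mulmx_col2 !mxE /=; ring. Qed.

Lemma wrap_strip_a O i z : Num.floor (z 1 0) = 0 ->
  wrap O (i, z) = (zpow (sigma_a O) (Num.floor (z 0 0)) i, z - vec (Num.floor (z 0 0))%:~R 0).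
Proof. by move=> y0; rewrite /wrap /= y0 zpow0x. Qed.

Lemma wrap_strip_b O i z : Num.floor (z 0 0) = 0 ->
  wrap O (i, z) = (zpow (sigma_b O) (Num.floor (z 1 0)) i, z - vec 0 (Num.floor (z 1 0))%:~R).
Proof. by move=> x0; rewrite /wrap /= x0 zpow0x. Qed.

(** Inside a horizontal strip the shear is compatible with the shifts by [a]. Across a lower edge
    the sheared squares are offset by [k] horizontal steps, which the factor [a^-k] in [sigma_b O']
    compensates. *)
Lemma shear_affine O O' (k : int) :
  sigma_a O' = sigma_a O -> sigma_b O' = (zpow (sigma_a O) (- k) * sigma_b O)%g ->
  affine_map (shear k%:~R) (@linear_map O O' (shear k%:~R)).
Proof.
move=> eq_a eq_b.
(* Small moves from a lower edge stay in the square or enter the one below, so [n] is 0 or -1; for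
   other [n] the two sides may differ, as [a] and [b] need not commute. *)
have bN n i : n = 0 \/ n = -1 -> zpow (sigma_a O) (- (k * n)) (zpow (sigma_b O) n i)
    = zpow (sigma_b O') n i.
  case=> ->; first by rewrite mulr0 !zpow0x.
  by rewrite mulrN1 opprK !(@zpowN _ _ 1) eq_b [zpow _ 1]/= expg1 invMg permM zpowN invgK.
apply: linear_map_affine => [z|i z z_cell z_off].
  rewrite /off_lattice shearx sheary; case y_int: (z 1 0 \is a Num.int); last by rewrite !andbF.
  by rewrite !andbT rpredDr // rpredM ?intr_int.
case: (cell_cases z_cell z_off) => [/[dup] y01 /andP[y0 y1]|[/[dup] x01 /andP[x0 x1] y0]].
  apply: near0_mono (near0_itv 1 y0 y1) => v h.
  have fy : Num.floor ((z + v) 1 0) = 0 by rewrite mxE floor_in01.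
  split; first by left; rewrite !sheary fy floor_in01.
  rewrite [X in (X.1, _ *m X.2)]wrap_strip_a //= mulmxBr -eq_a.
  have -> : shear k%:~R *m vec (Num.floor ((z + v) 0 0))%:~R 0
      = vec (Num.floor ((z + v) 0 0))%:~R 0 :> plane.
    by apply: plane_eq; rewrite ?shearx ?sheary ?vecx ?vecy ?mulr0 ?addr0.
  by rewrite wrap_shift_a // sheary.
have near_x := near0_itv 0 x0 x1.
have near_Sx : near0 (fun v => 0 < z 0 0 + (shear k%:~R *m v) 0 0 < 1).
  exact: near0_mul near_x.
have near_y : near0 (fun v => -1 < z 1 0 + v 1 0 < 1) by apply: near0_itv; lra.
apply: near0_mono (near0_and near_x (near0_and near_Sx near_y)) => v [hx [hSx hy]].
have fx : Num.floor ((z + v) 0 0) = 0 by rewrite mxE floor_in01.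
have fSx : Num.floor ((shear k%:~R *m (z + v)) 0 0) = 0.
  by rewrite mulmxDr mxE shearx y0 mulr0 addr0 floor_in01.
split; first by right; rewrite fSx shearx y0 mulr0 addr0 floor_in01.
rewrite [X in (X.1, _ *m X.2)]wrap_strip_b //=.
set n := Num.floor _.
have n01 : n = 0 \/ n = -1.
  case/andP: hy => hy1 hy2; case: (lerP 0 (z 1 0 + v 1 0)) => hy0; [left|right];
    by apply: floorE; rewrite mxE /=; lra.
rewrite -(@wrap_shift_b _ _ O' i (shear k%:~R *m (z + v)) n) //.
rewrite -(bN n i n01) -(@wrap_shift_a _ _ O' _ (_ - vec 0 _) (k * n)).
  rewrite eq_a -zpowDx subrr zpow0x; congr (wrap _ (_, _)).
  by apply: plane_eq; rewrite !(shearx, sheary, mxE) /= ?intrM; ring.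
have -> : (shear k%:~R *m (z + v) - vec 0 n%:~R) 1 0 = (z + v) 1 0 - n%:~R.
  by rewrite mxE sheary !mxE.
apply: floorE; rewrite /=.
  by rewrite subr_ge0 floor_le.
by rewrite add0r ltrBlDl; have := floorD1_gt ((z + v) 1 0); rewrite intrD.
Qed.

(** A sheared cell stays in its horizontal strip, so both developments use powers of the common [a]
    only, and the integral shifts cancel. *)
Lemma shear_cancel O O' (k : int) :
  sigma_a O' = sigma_a O ->
  cancel (@linear_map O O' (shear k%:~R)) (@linear_map O' O (shear (- k)%:~R)).
Proof.
move=> eq_a.
suff key i z : in_cell z -> off_lattice z ->
    linear_map (shear (- k)%:~R) (pt O' (wrap O' (i, shear k%:~R *m z))) = pt O (i, z).
  move=> P; rewrite -[RHS]coordK [in RHS](surjective_pairing (coord P)).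
  exact: key (coord_cell P) (coord_off_lattice P).
move=> z_cell z_off; rewrite /linear_map.
have fy : Num.floor ((shear k%:~R *m z) 1 0) = 0.
  by case/andP: z_cell => _ /andP[? ?]; rewrite sheary; apply: floorE; rewrite /= ?add0r.
have Sz_off : off_lattice (shear k%:~R *m z).
  move: z_off; rewrite /off_lattice shearx sheary.
  case y_int: (z 1 0 \is a Num.int); last by rewrite !andbF.
  by rewrite !andbT rpredDr // rpredM ?intr_int.
rewrite coord_wrap // [wrap O' _]wrap_strip_a // eq_a [(_, _).1]/= [(_, _).2]/=.
set m := Num.floor _.
have -> : shear (- k)%:~R *m (shear k%:~R *m z - vec m%:~R 0)
    = z - vec m%:~R 0.
  by apply: plane_eq; rewrite !(shearx, sheary, mxE) /= ?intrN; ring.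
rewrite wrap_shift_a; last by move: fy; rewrite sheary.
by rewrite wrap_id.
Qed.

Lemma affine_equiv_shear O O' (k : int) :
  sigma_a O' = sigma_a O -> sigma_b O' = (zpow (sigma_a O) (- k) * sigma_b O)%g ->
  affine_equiv O O' (shear k%:~R).
Proof.
move=> eq_a eq_b; exists (linear_map (shear k%:~R)); split; last exact: shear_affine.
exists (linear_map (shear (- k)%:~R)); first exact: shear_cancel.
by rewrite -{2}(opprK k); apply: shear_cancel.
Qed.

Lemma swap_affine O O' : sigma_a O' = sigma_b O -> sigma_b O' = sigma_a O ->
  affine_map (swap R) (@linear_map O O' (swap R)).
Proof.
move=> eq_a eq_b; apply: linear_map_affine => [z|i z z_cell z_off].
  by rewrite /off_lattice swapx swapy andbC.
have swap_vec x y : swap R *m vec x y = vec y x.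
  by apply: plane_eq; rewrite ?swapx ?swapy !mxE.
case: (cell_cases z_cell z_off) => [/[dup] y01 /andP[y0 y1]|[/[dup] x01 /andP[x0 x1] y0]].
  apply: near0_mono (near0_itv 1 y0 y1) => v h.
  have fy : Num.floor ((z + v) 1 0) = 0 by rewrite mxE floor_in01.
  split; first by right; rewrite !swapx fy floor_in01.
  rewrite [X in (X.1, _ *m X.2)]wrap_strip_a //= mulmxBr swap_vec -eq_b.
  by rewrite wrap_shift_b // swapx.
apply: near0_mono (near0_itv 0 x0 x1) => v h.
have fx : Num.floor ((z + v) 0 0) = 0 by rewrite mxE floor_in01.
split; first by left; rewrite !swapy fx floor_in01.
rewrite [X in (X.1, _ *m X.2)]wrap_strip_b //= mulmxBr swap_vec -eq_a.
by rewrite wrap_shift_a // swapy.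
Qed.

Lemma swap_cancel O O' : cancel (@linear_map O O' (swap R)) (@linear_map O' O (swap R)).
Proof.
suff key i z : in_cell z -> off_lattice z ->
    linear_map (swap R) (pt O' (wrap O' (i, swap R *m z))) = pt O (i, z).
  move=> P; rewrite -[RHS]coordK [in RHS](surjective_pairing (coord P)).
  exact: key (coord_cell P) (coord_off_lattice P).
move=> z_cell z_off; rewrite /linear_map.
have Sz_cell : in_cell (swap R *m z) by rewrite /in_cell swapx swapy andbC.
have Sz_off : off_lattice (swap R *m z).
  by rewrite /off_lattice swapx swapy andbC.
rewrite coord_wrap // [wrap O' _]wrap_id // [(_, _).1]/= [(_, _).2]/=.
have -> : swap R *m (swap R *m z) = z.
  by apply: plane_eq; rewrite !(swapx, swapy).
by rewrite wrap_id.
Qed.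

Lemma affine_equiv_swap O O' : sigma_a O' = sigma_b O -> sigma_b O' = sigma_a O ->
  affine_equiv O O' (swap R).
Proof.
move=> eq_a eq_b; exists (linear_map (swap R)); split; last exact: swap_affine.
by exists (linear_map (swap R)); apply: swap_cancel.
Qed.

End AffineMaps.

(** * Geodesics and their periods *)

Section Geodesics.
Variables (R : realType) (d : nat).
Local Notation plane := 'cV[R]_2.
Implicit Types (O : origami d) (z v w : plane) (i j : 'I_d).

Definition geodesic O (g : R -> surface R O) v : Prop :=
  forall t, exists2 e : R, 0 < e &
    forall s, `|s| < e -> g (t + s) = translate (g t) (s *: v).

Lemma geodesic_affine O O' (A : 'M[R]_2) (f : surface R O -> surface R O') g v :
  affine_map A f -> geodesic g v -> geodesic (f \o g) (A *m v).
Proof.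
move=> fA g_geo t; have [e e0 he] := g_geo t.
have [e' e'0 he'] := near0_line v (fA (g t)).
exists (Num.min e e') => [|s]; first by rewrite lt_min e0.
by rewrite lt_min => /andP[/he /= -> /he' ->]; rewrite scalemxAr.
Qed.

(** Lets agreement of two geodesics propagate backwards, so that the set of times at which they
    agree is closed as well as open. *)
Lemma translate_inj O (P Q : surface R O) v :
  off_lattice ((coord P).2 + v) -> off_lattice ((coord Q).2 + v) ->
  translate P v = translate Q v -> P = Q.
Proof.
move=> hP hQ /(congr1 (@coord _ _ _)); rewrite /translate !coord_wrap // => e.
have [ix iy] : ((coord P).2 - (coord Q).2) 0 0 \is a Num.int /\
    ((coord P).2 - (coord Q).2) 1 0 \is a Num.int.
  have <- : (coord P).2 + v - ((coord Q).2 + v) = (coord P).2 - (coord Q).2.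
    by rewrite opprD addrACA subrr addr0.
  exact: wrap_eq_int e.
have /andP[/andP[? ?] /andP[? ?]] := coord_cell P.
have /andP[/andP[? ?] /andP[? ?]] := coord_cell Q.
have key (x y : R) : 0 <= x -> x < 1 -> 0 <= y -> y < 1 -> x - y \is a Num.int -> x = y.
  by move=> ? ? ? ? xy; apply/eqP; rewrite -subr_eq0 (int_small xy) //; lra.
have zPQ : (coord P).2 = (coord Q).2.
  by apply: plane_eq; apply: key => //; [move: ix | move: iy]; rewrite !mxE.
apply: coord_inj; rewrite (surjective_pairing (coord P)) (surjective_pairing (coord Q)).
rewrite zPQ; congr (_, _); move: e; rewrite /wrap zPQ => -[].
by move=> /perm_inj /perm_inj.
Qed.

Lemma geodesic_near_off_lattice O (g : R -> surface R O) v t :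
  exists2 e : R, 0 < e & forall s, `|s| < e -> off_lattice ((coord (g t)).2 + s *: v).
Proof. exact: near0_line (near0_off_lattice (coord_cell _) (coord_off_lattice _)). Qed.

Lemma geodesic_unique O (g h : R -> surface R O) v :
  geodesic g v -> geodesic h v -> g 0 = h 0 -> forall t, g t = h t.
Proof.
move=> g_geo h_geo; apply: (@locally_constant _ (fun t => g t = h t)) => t.
have [e1 e1_0 H1] := g_geo t; have [e2 e2_0 H2] := h_geo t.
have [e3 e3_0 H3] := geodesic_near_off_lattice g v t.
have [e4 e4_0 H4] := geodesic_near_off_lattice h v t.
exists (Num.min (Num.min e1 e2) (Num.min e3 e4)) => [|s].
  by rewrite !lt_min e1_0 e2_0 e3_0.
rewrite !lt_min => /andP[/andP[s1 s2] /andP[s3 s4]].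
rewrite H1 // H2 //; split=> [|-> //].
by apply: translate_inj; [apply: H3|apply: H4].
Qed.

Definition integral z : Prop := forall k : 'I_2, z k 0 \is a Num.int.

Lemma integralP z : z 0 0 \is a Num.int -> z 1 0 \is a Num.int -> integral z.
Proof.
by move=> z0 z1 [[|[|//]] lt_k]; [move: z0|move: z1]; congr (is_true (z _ _ \is a _));
  apply: val_inj.
Qed.

Lemma integralD z w : integral z -> integral w -> integral (z + w).
Proof. by move=> hz hw k; rewrite mxE rpredD. Qed.

Lemma integralN z : integral z -> integral (- z).
Proof. by move=> hz k; rewrite mxE rpredN. Qed.

Lemma integral_vec (m n : int) : integral (vec m%:~R n%:~R : plane).
Proof. by apply: integralP; rewrite mxE intr_int. Qed.

(** The covering sends [g] to a straight line of the torus: [wrap] removes integral vectors only, so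
    the class modulo the lattice is locally constant. *)
Lemma geodesic_coord O (g : R -> surface R O) v : geodesic g v ->
  forall t, integral ((coord (g t)).2 - (coord (g 0)).2 - t *: v).
Proof.
move=> g_geo; apply: locally_constant => [t|]; last first.
  by rewrite subrr scale0r subrr; apply: integralP; rewrite mxE.
have [e1 e1_0 H1] := g_geo t; have [e3 e3_0 H3] := geodesic_near_off_lattice g v t.
exists (Num.min e1 e3) => [|s]; first by rewrite lt_min e1_0.
rewrite lt_min => /andP[s1 s3]; rewrite H1 // /translate coord_wrap ?H3 //.
set x := Num.floor (((coord (g t)).2 + s *: v) 0 0).
set y := Num.floor (((coord (g t)).2 + s *: v) 1 0).
set u := (coord (g t)).2 - _ - _.
have -> : (wrap O ((coord (g t)).1, (coord (g t)).2 + s *: v)).2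
   - (coord (g 0)).2 - (t + s) *: v = u - vec x%:~R y%:~R.
  by apply: plane_eq; rewrite !mxE /= /x /y !mxE; ring.
split; last by move=> hu; apply: integralD hu (integralN (integral_vec _ _)).
move=> hu; rewrite -(subrK (vec x%:~R y%:~R) u).
exact: integralD hu (integral_vec _ _).
Qed.

Definition horizontal O i (y t : R) : surface R O := pt O (wrap O (i, vec t y)).
Definition vertical O i (x t : R) : surface R O := pt O (wrap O (i, vec x t)).

Lemma horizontal_geodesic O i y : 0 < y < 1 -> geodesic (horizontal O i y) (vec 1 0).
Proof.
(* Any radius would do, as the whole line lies in one strip. *)
move=> y01 t; exists 1 => // s _; rewrite /horizontal.
have -> : s *: vec 1 0 = vec (t + s) y - vec t y :> plane.
  by apply: plane_eq; rewrite !mxE /=; ring.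
rewrite translate_wrap //; last by left; rewrite !vecy floor_in01.
by rewrite /off_lattice vecy (nint_in01 y01) andbF.
Qed.

Lemma vertical_geodesic O i x : 0 < x < 1 -> geodesic (vertical O i x) (vec 0 1).
Proof.
move=> x01 t; exists 1 => // s _; rewrite /vertical.
have -> : s *: vec 0 1 = vec x (t + s) - vec x t :> plane.
  by apply: plane_eq; rewrite !mxE /=; ring.
rewrite translate_wrap //; last by right; rewrite !vecx floor_in01.
by rewrite /off_lattice vecx nint_in01.
Qed.

Lemma horizontal_shift O i y t (n : int) : 0 < y < 1 ->
  horizontal O i y (t + n%:~R) = horizontal O (zpow (sigma_a O) n i) y t.
Proof.
move=> y01; rewrite /horizontal -(@wrap_shift_a _ _ O i (vec (t + n%:~R) y) n).
  by congr (pt _ (wrap _ (_, _))); apply: plane_eq; rewrite !mxE /=; ring.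
by rewrite vecy floor_in01.
Qed.

Lemma vertical_shift O i x t (n : int) : 0 < x < 1 ->
  vertical O i x (t + n%:~R) = vertical O (zpow (sigma_b O) n i) x t.
Proof.
move=> x01; rewrite /vertical -(@wrap_shift_b _ _ O i (vec x (t + n%:~R)) n).
  by congr (pt _ (wrap _ (_, _))); apply: plane_eq; rewrite !mxE /=; ring.
by rewrite vecx floor_in01.
Qed.

Lemma closed_geodesic_integral O (g : R -> surface R O) v :
  geodesic g v -> g 1 = g 0 -> integral v.
Proof.
move=> g_geo g10; have := geodesic_coord g_geo 1.
by rewrite g10 subrr scale1r sub0r => /integralN; rewrite opprK.
Qed.

Lemma half_in01 : 0 < (2^-1 : R) < 1.
Proof. by apply/andP; split; lra. Qed.

(** A fixed point of [sigma_a] gives a horizontal geodesic closing after time 1; its image closes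
    too and has vector [A *m vec 1 0]. *)
Lemma affine_equiv_integral_a O O' (A : 'M[R]_2) i :
  affine_equiv O O' A -> sigma_a O i = i -> integral (A *m vec 1 0).
Proof.
case=> f [_ fA] ai.
apply: (closed_geodesic_integral (geodesic_affine fA (horizontal_geodesic O i half_in01))).
have := horizontal_shift O i 0 1 half_in01; rewrite add0r [zpow _ _]/= expg1 ai.
by move=> /= ->.
Qed.

Lemma affine_equiv_integral_b O O' (A : 'M[R]_2) i :
  affine_equiv O O' A -> sigma_b O i = i -> integral (A *m vec 0 1).
Proof.
case=> f [_ fA] bi.
apply: (closed_geodesic_integral (geodesic_affine fA (vertical_geodesic O i half_in01))).
have := vertical_shift O i 0 1 half_in01; rewrite add0r [zpow _ _]/= expg1 bi.
by move=> /= ->.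
Qed.

(* A horizontal line at integral height runs into a puncture. *)
Lemma geodesic_horizontal O (g : R -> surface R O) : geodesic g (vec 1 0) ->
  exists i y x, 0 < y < 1 /\ forall t, g t = horizontal O i y (t + x).
Proof.
move=> g_geo; case eP: (coord (g 0)) => [i z].
have [x_y01] : 0 < z 1 0 < 1.
  have := coord_cell (g 0); rewrite eP => /andP[_ /= /andP[y0 y1]].
  rewrite y1 lt_neqAle y0 !andbT eq_sym; apply/eqP => y_0.
  have ez : (coord (g 0)).2 = z by rewrite eP.
  set t := - z 0 0.
  have t_int : integral (coord (g t)).2.
    have -> : (coord (g t)).2 = (coord (g t)).2 - z - t *: vec 1 0 + (z + t *: vec 1 0).
      by rewrite -[_ - z - _]addrA -opprD subrK.
    apply: integralD; first by rewrite -ez; apply: geodesic_coord.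
    by apply: integralP; rewrite !mxE /= ?y_0 /t ?mulr0 ?addr0 ?mulr1 ?subrr ?int_num0.
  by have := coord_off_lattice (g t); rewrite /off_lattice !t_int.
exists i, (z 1 0), (z 0 0); split=> //.
apply: (geodesic_unique g_geo) => [t|].
  have [e e0 he] := horizontal_geodesic O i x_y01 (t + z 0 0).
  by exists e => // s /he <-; rewrite addrAC.
rewrite add0r /horizontal -[LHS]coordK eP; congr pt.
have -> : vec (z 0 0) (z 1 0) = z by apply: plane_eq; rewrite mxE.
by have := coord_cell (g 0); rewrite eP => /(@wrap_id _ _ O (i, z)).
Qed.

(** A translation sends horizontal geodesics to horizontal geodesics of the same speed, so by
    injectivity a common period in [O'] is one in [O]. *)
Lemma translation_period O O' (n : int) :
  affine_equiv O O' (1%:M : 'M[R]_2) -> zpow (sigma_a O') n = 1%g -> zpow (sigma_a O) n = 1%g.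
Proof.
case=> f [f_bij f1] an; apply/permP => i; rewrite perm1.
have := geodesic_affine f1 (horizontal_geodesic O i half_in01); rewrite mul1mx.
move=> /geodesic_horizontal[j [y [x [y01 fE]]]].
have : horizontal O i 2^-1 (0 + n%:~R) = horizontal O i 2^-1 0.
  apply: (bij_inj f_bij); have /= -> := fE (0 + n%:~R); have /= -> := fE 0.
  by rewrite addrAC horizontal_shift // an perm1.
rewrite horizontal_shift ?half_in01 // => /(congr1 (@coord _ _ _)).
rewrite !coord_wrap ?/off_lattice ?vecy ?(nint_in01 half_in01) ?andbF //.
have half01 := half_in01.
have c : in_cell (vec 0 2^-1 : plane) by rewrite /in_cell vecx vecy lexx ltr01; lra.
by rewrite !wrap_id // => -[].
Qed.

End Geodesics.

(** * Group structure of the Veech group and existence of sheared origamis *)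

Section Veech.
Variables (R : realType) (d : nat).
Implicit Types (O : origami d) (A B : 'M[R]_2).

Lemma veech_groupE O A :
  veech_group R O A <-> affine_equiv O O A /\ 0 < \det A.
Proof.
split=> [[f [f_bij /affine_in_chartsE fA detA]]|[[f [f_bij /affine_in_chartsE fA]] detA]].
  by split=> //; exists f.
by exists f.
Qed.

Lemma unitmx_det_gt0 A : 0 < \det A -> A \in unitmx.
Proof. by move=> h; rewrite unitmxE unitfE gt_eqF. Qed.

Lemma veech_group1 O : veech_group R O 1%:M.
Proof. by apply/veech_groupE; split; [apply: affine_equiv_refl|rewrite det1]. Qed.

Lemma veech_groupM O A B :
  veech_group R O A -> veech_group R O B -> veech_group R O (A *m B).
Proof.
move=> /veech_groupE[hA dA] /veech_groupE[hB dB]; apply/veech_groupE.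
by split; [apply: affine_equiv_comp hB hA|rewrite det_mulmx mulr_gt0].
Qed.

Lemma veech_groupV O A : veech_group R O A -> veech_group R O (invmx A).
Proof.
move=> /veech_groupE[hA dA]; apply/veech_groupE; split; last by rewrite det_inv invr_gt0.
exact: affine_equiv_inv (unitmx_det_gt0 dA) hA.
Qed.

(** Transitivity is inherited from the group of [O], which is contained in the group generated by
    [s] and [t]. *)
Lemma origami_exists O (s t : 'S_d) :
  sigma_a O \in <<[set s; t]%SET>>%g -> sigma_b O \in <<[set s; t]%SET>>%g ->
  exists O', sigma_a O' = s /\ sigma_b O' = t.
Proof.
move=> Oa Ob; have O_trans := origami_transitive O.
have sub : <<[set sigma_a O; sigma_b O]%SET>>%g \subset <<[set s; t]%SET>>%g.
  by rewrite gen_subG; apply/fintype.subsetP => u; rewrite !inE => /orP[]/eqP->.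
have st_trans : [transitive <<[set s; t]%SET>>, on [set: 'I_d]%SET | 'P].
  rewrite (atrans_supgroup sub O_trans); apply/actsP => u _ i.
  by rewrite !inE.
by exists (Origami st_trans).
Qed.

Lemma exists_shear O (k : int) : exists O',
  sigma_a O' = sigma_a O /\ sigma_b O' = (zpow (sigma_a O) (- k) * sigma_b O)%g.
Proof.
set a := sigma_a O; set b := sigma_b O.
have a_in : a \in <<[set a; zpow a (- k) * b]%SET>>%g by rewrite mem_gen // !inE eqxx.
apply: (@origami_exists O) => //.
rewrite -[sigma_b O](mulKg (zpow a (- k))) -zpowN opprK groupM ?mem_zpow //.
by rewrite mem_gen // !inE eqxx orbT.
Qed.

Lemma exists_swap O : exists O', sigma_a O' = sigma_b O /\ sigma_b O' = sigma_a O.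
Proof. by apply: (@origami_exists O); rewrite mem_gen // !inE eqxx ?orbT. Qed.

Definition lower_shear (T : nzRingType) (k : T) : 'M[T]_2 := mx2 1 0 k 1.

(** Conjugation by the swap turns an upper shear into a lower one and exchanges the roles of the two
    permutations. *)
Lemma affine_equiv_lower_shear O O' (k : int) :
  sigma_b O' = sigma_b O -> sigma_a O' = (zpow (sigma_b O) (- k) * sigma_a O)%g ->
  affine_equiv O O' (lower_shear (k%:~R : R)).
Proof.
move=> eq_b eq_a; have [U1 [a1 b1]] := exists_swap O.
have [U2 [a2 b2]] := exists_shear U1 k.
have -> : lower_shear (k%:~R : R) = swap R *m (shear k%:~R *m swap R).
  by rewrite !mulmx2; congr mx2; ring.
apply: affine_equiv_comp (affine_equiv_comp (affine_equiv_swap _ a1 b1)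
  (affine_equiv_shear _ a2 b2)) (affine_equiv_swap _ _ _).
  by rewrite b2 a1 b1.
by rewrite a2 a1.
Qed.

Lemma exists_lower_shear O (k : int) : exists O',
  sigma_b O' = sigma_b O /\ sigma_a O' = (zpow (sigma_b O) (- k) * sigma_a O)%g.
Proof.
have [U1 [a1 b1]] := exists_swap O; have [U2 [a2 b2]] := exists_shear U1 k.
by have [U3 [a3 b3]] := exists_swap U2; exists U3; rewrite a3 b3 a2 b2 a1 b1.
Qed.

(** The determinants of [A] and of its inverse are integers with product 1, and the first is
    positive. *)
Lemma integral_det1 A : (forall i j, A i j \is a Num.int) ->
  (forall i j, invmx A i j \is a Num.int) -> 0 < \det A -> SL2Z A.
Proof.
move=> A_int A'_int detA.
have lift (M : 'M[R]_2) : (forall i j, M i j \is a Num.int) ->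
    exists N : 'M[int]_2, map_mx intr N = M.
  move=> M_int; exists (\matrix_(i, j) Num.floor (M i j)).
  by apply/matrixP => i j; rewrite !mxE floorK.
have [B eqB] := lift _ A_int; have [C eqC] := lift _ A'_int.
exists B => //=; move: detA; rewrite -eqB det_map_mx ltr0z => detB.
have : \det B * \det C = 1.
  apply: (@intr_inj R); rewrite intrM -!det_map_mx eqB eqC -det_mulmx mulmxV ?det1 //.
  by apply: unitmx_det_gt0; rewrite -eqB det_map_mx ltr0z.
move: detB; move: (\det B) (\det C) => x y x0 xy.
have : x \is a GRing.unit by apply/unitrPr; exists y.
by case/orP => /eqP // x_N1; rewrite x_N1 in x0.
Qed.

End Veech.

(** * The origami [D] and the commutator of two shears *)

Lemma D_aE : [/\ D_a 1 = 2, D_a 2 = 3, D_a 3 = 1, D_a 4 = 4 & D_a 5 = 5].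
Proof. by split; rewrite permE. Qed.

Lemma D_bE : [/\ D_b 1 = 4, D_b 4 = 5, D_b 5 = 1, D_b 2 = 3 & D_b 3 = 2].
Proof. by split; rewrite permE. Qed.

Lemma D_a3 : (D_a ^+ 3 = 1)%g.
Proof.
case: D_aE => a1 a2 a3 a4 a5; apply/permP; apply: I5_cases;
  by rewrite !expgS expg0 !permM !perm1 !(a1, a2, a3, a4, a5).
Qed.

Lemma D_b6 : (D_b ^+ 6 = 1)%g.
Proof.
case: D_bE => b1 b4 b5 b2 b3; apply/permP; apply: I5_cases;
  by rewrite !expgS expg0 !permM !perm1 !(b1, b2, b3, b4, b5).
Qed.

Lemma D_ab4 : ((D_a * D_b) ^+ 4 = 1)%g.
Proof.
case: D_aE => a1 a2 a3 a4 a5; case: D_bE => b1 b4 b5 b2 b3.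
by apply/permP; apply: I5_cases;
  rewrite !expgS expg0 !permM !perm1 !(b1, b2, b3, b4, b5, a1, a2, a3, a4, a5).
Qed.

Lemma veech_group_D_SL2Z (R : realType) : veech_group R D `<=` @SL2Z R.
Proof.
have int_entries (A : 'M[R]_2) : veech_group R D A -> forall i j, A i j \is a Num.int.
  move=> /veech_groupE[hA _].
  have hx : integral (A *m vec 1 0).
    by apply: (affine_equiv_integral_a (i := 4) hA); case: D_aE.
  (* The second permutation of [D1] fixes the square 3: [a^-1] sends 3 to 2 and [b] sends 2 back to
     3. *)
  have [D1 [a1 b1]] := exists_shear D 1.
  have D1D : affine_equiv D1 D (shear (- 1)%:~R : 'M[R]_2).
    by apply: affine_equiv_shear; rewrite ?a1 // b1 opprK mulgA -zpowD subrr mul1g.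
  have hxy : integral (A *m shear (- 1)%:~R *m vec 0 1).
    apply: (affine_equiv_integral_b (i := 3) (affine_equiv_comp D1D hA)).
    case: D_aE => a1' a2' a3' _ _; case: D_bE => _ _ _ b2' _.
    rewrite b1 zpowN permM.
    have -> : (zpow (sigma_a D) 1)^-1%g 3 = 2 by apply: (canLR (permK _)); rewrite /= expg1.
    exact: b2'.
  have hy : integral (A *m vec 0 1).
    (* This is (0, 1) = (-1, 1) + (1, 0), the first summand being the sheared vertical vector. *)
    have -> : A *m vec 0 1 = A *m shear (- 1)%:~R *m vec 0 1 + A *m vec 1 0.
      rewrite -mulmxA -mulmxDr; congr (_ *m _); apply: plane_eq;
        by rewrite [RHS]mxE ?shearx ?sheary !mxE /=; ring.
    exact: integralD.
  move=> i [[|[|//]] lt_j].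
    by have := hx i; rewrite mulmx_col2 !mxE /= mulr1 mulr0 addr0;
      congr (is_true (A _ _ \is a _)); apply: val_inj.
  by have := hy i; rewrite mulmx_col2 !mxE /= mulr1 mulr0 add0r;
    congr (is_true (A _ _ \is a _)); apply: val_inj.
move=> A hA; have [_ detA] := (veech_groupE _ _).1 hA.
apply: integral_det1 detA; first exact: int_entries.
exact: int_entries (veech_groupV hA).
Qed.

Definition commutator_mx (T : comNzRingType) (x y : T) : 'M[T]_2 :=
  shear x *m (lower_shear y *m (shear (- x) *m lower_shear (- y))).

(** Every entry differs from that of the identity by a multiple of [x * y], whence the congruence
    condition when [n] divides [x * y]. *)
Lemma commutator_mxE (T : comNzRingType) (x y : T) : commutator_mx x y =
  mx2 (1 + x * y + x * y * (x * y)) (- (x * y) * x) (x * y * y) (1 - x * y).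
Proof. by rewrite /commutator_mx !mulmx2; congr mx2; ring. Qed.

Lemma commutator_principal (R : realType) (n : nat) (x y : int) :
  (n%:Z %| x * y)%Z -> principal_congruence n (commutator_mx (x%:~R : R) y%:~R).
Proof.
move=> /dvdzP[q xy]; exists (commutator_mx x y); last first.
  by rewrite !commutator_mxE map_mx2; congr mx2; rewrite ?(intrD, intrB, intrN, intrM).
have modn (u v : int) : (exists w, u - v = w * n%:Z) -> (u = v %[mod n%:Z])%Z.
  by move=> uv; apply/eqP; rewrite eqz_mod_dvd; apply/dvdzP.
split; first by rewrite /commutator_mx !det_mulmx !det_mx2; ring.
rewrite commutator_mxE xy => -[[|[|//]] i] [[|[|//]] j]; rewrite !mxE /=; apply: modn.
- by exists (q + q * (q * n%:Z)); ring.
- by exists (- q * x); ring.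
- by exists (q * y); ring.
- by exists (- q); ring.
Qed.

Theorem proposition4p1 (R : realType) : noncongruence_group (veech_group R D).
Proof.
have sub : subgroup_SL2Z (veech_group R D).
  split; [exact: veech_group_D_SL2Z | exact: veech_group1
         | exact: veech_groupM | exact: veech_groupV].
split=> // -[_ [n n_gt0 congr_n]].
have [m m_odd n_eq] := pfactor_coprime (isT : prime 2) n_gt0.
rewrite coprime2n in m_odd; move: (logn 2 n) n_eq => k n_eq.
pose x := Posz (4 ^ k); pose y := Posz (6 * m).
have n_xy : (n%:Z %| x * y)%Z.
  rewrite n_eq; apply/dvdzP; exists (Posz (2 ^ k * 6)).
  rewrite /x /y -!PoszM (_ : 4 = 2 * 2)%N // expnMn; congr Posz.
  by move: (2 ^ k)%N => p; ring.
have ax : zpow D_a x = D_a.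
  rewrite /x /=; elim: k {n_eq x n_xy} => [|k IH]; first by rewrite expg1.
  by rewrite expnSr expgnA IH expgS D_a3 mulg1.
have by1 : zpow D_b y = 1%g by rewrite /y /= expgnA D_b6 expg1n.
have aby : zpow (D_a * D_b)%g y = ((D_a * D_b) ^+ 2)%g.
  (* With m = 2h + 1 one has 6m = 4(3h + 1) + 2. *)
  have -> : y = Posz (4 * (3 * m./2 + 1) + 2) by rewrite /y; congr Posz; lia.
  by rewrite /= expgnDr expgnA D_ab4 expg1n mul1g.
(* The factors of the commutator act from right to left. The lower shear by [- y] preserves [D]
   since [b^y = 1]; then [b] becomes [a^x * b = a * b], next [a] becomes [(a * b)^-y * a], and the
   last shear keeps this permutation. Products are read from left to right. *)
have [D2 [a2 b2]] := exists_shear D (- x).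
have [D3 [b3 a3]] := exists_lower_shear D2 y.
have [D4 [a4 b4]] := exists_shear D3 x.
have DD : affine_equiv D D (lower_shear ((- y)%:~R : R)).
  by apply: affine_equiv_lower_shear; rewrite // opprK by1 mul1g.
have := affine_equiv_comp (affine_equiv_comp (affine_equiv_comp DD
  (affine_equiv_shear R a2 b2)) (affine_equiv_lower_shear R b3 a3)) (affine_equiv_shear R a4 b4).
rewrite !intrN -/(commutator_mx _ _) => D_D4.
have /veech_groupE[DA detA] := congr_n _ (commutator_principal R n_xy).
have uA := unitmx_det_gt0 detA.
(* Going back from [D4] to [D] and then applying the assumed automorphism of [D] with the same
   linear part leaves a translation from [D4] to [D]. *)
have := affine_equiv_comp (affine_equiv_inv uA D_D4) DA; rewrite mulmxV // => D4_D.
have := translation_period (n := 3) D4_D D_a3.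
rewrite a4 a3 a2 b2 opprK ax zpowN aby => /permP/(_ 1); rewrite perm1.
(* The first permutation of [D4] is thus [(a * b)^2 * a], which sends 1 to 4, 4 to 2 and 2 to 3; its
   cube moves 1 to 3 and is not the identity. *)
have -> : ((D_a * D_b) ^+ 2)^-1%g = ((D_a * D_b) ^+ 2)%g.
  by apply: (@mulIg _ ((D_a * D_b) ^+ 2)%g); rewrite mulVg -expgnDr D_ab4.
case: D_aE => a1 a2' a3' a4' a5; case: D_bE => b1 b4' b5 b2' b3'.
by rewrite /= !expgS expg0 !permM !perm1 !(b1, b2', b3', b4', b5, a1, a2', a3', a4', a5).
Qed.
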